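(* Let $P=\{x\in\mathbb{R}^n : Ax=b,\ Dx\le d\}$ be a $0/1$ polytope of dimension $\dim P$, and consider the linear program $\max\{c^\top x : x\in P\}$, where $A,D,b,d,c$ are integral. Let $x^0$ be an initial vertex of $P$ and let $\Gamma=[x^0,x^1,\dots]$ be a path followed by the Ordered Shadow rule from $x^0$. Define $f:\mathbb{R}^n\to\{0,1,\dots,n\}$ by $f(u)=\max(\{k : u(k)-x^0(k)\ne 0\}\cup\{0\})$, and for a vertex $x$ of $P$ let $N_{\min}(x)$ be the set of those $c$-improving neighbors of $x$ at which $f$ is minimal among all $c$-improving neighbors of $x$. Then for every $i$ for which $x^{i+1}$ is defined, $x^{i+1}$ is a $c$-maximum of $N_{\min}(x^i)$. Hence the number of steps taken by the Ordered Shadow rule to arrive at an optimal solution is at most $\dim P$.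
   Context: A $0/1$ polytope is a polytope all of whose extreme points lie in $\{0,1\}^n$. Two vertices of $P$ are neighbors if they are joined by an edge of $P$. For a vertex $x$ and $w\in\mathbb{R}^n$, a neighbor $u$ of $x$ is $w$-improving if $w^\top u>w^\top x$; $N_w(x)$ denotes the set of $w$-improving neighbors of $x$. A $c$-maximum of a set is an element of it maximizing $c^\top u$. Ordered Shadow rule. Given an initial vertex $x^0$ of $P$, let $c^*=\|c\|_1+2$ and define $v\in\mathbb{R}^n$ by $v(k)=(-1)^{x^0(k)}(c^* )^k$ for $k=1,\dots,n$ (fixed throughout). At a vertex $x^i$ that is not optimal for $c$, the rule moves in one step to $$x^{i+1}\in\operatorname*{arg\,max}_{u\in N_v(x^i)}\frac{c^\top(u-x^i)}{v^\top(u-x^i)},$$ any maximizer being allowed when it is not unique. The rule stops upon reaching an optimal solution. *)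

(* Defs.v *)
From mathcomp Require Import all_boot all_order all_algebra.
From mathcomp Require Import boolp classical_sets reals topology normedtype.

Set Implicit Arguments.
Unset Strict Implicit.
Unset Printing Implicit Defensive.

Import Order.TTheory GRing.Theory Num.Theory.
Import numFieldNormedType.Exports.

Local Open Scope classical_set_scope.
Local Open Scope ring_scope.

Definition argmax (R : realType) (T : Type) (S : set T) (g : T -> R) : set T :=
  [set u | S u /\ forall u', S u' -> g u' <= g u].

Definition dot (R : realType) (n : nat) (w x : 'cV[R]_n) : R :=
  (w^T *m x) 0 0.

Definition polyhedron (R : realType) (m p n : nat)
    (A : 'M[R]_(m, n)) (b : 'cV[R]_m) (D : 'M[R]_(p, n)) (d : 'cV[R]_p) :
    set 'cV[R]_n :=
  [set x | A *m x = b /\ forall i, (D *m x) i 0 <= d i 0].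

Definition vertex (R : realType) (n : nat) (P : set 'cV[R]_n) : set 'cV[R]_n :=
  [set x | P x /\ forall (y z : 'cV[R]_n) (t : R), P y -> P z -> 0 < t < 1 ->
     x = t *: y + (1 - t) *: z -> y = z].

Definition zero_one (R : realType) (n : nat) (x : 'cV[R]_n) : Prop :=
  forall k, x k 0 = 0 \/ x k 0 = 1.

(* The polyhedron P is a polytope iff it is bounded. *)
Definition zero_one_polytope (R : realType) (n : nat) (P : set 'cV[R]_n) : Prop :=
  bounded_set P /\ forall x, vertex P x -> zero_one x.

(* Affine dimension: the largest k such that S contains k + 1 affinely
   independent points q, p 0, ..., p (k - 1).
   With this convention the empty set gets dimension 0. *)
Definition affdim (R : realType) (n : nat) (S : set 'cV[R]_n) : nat :=
  (\max_(k < n.+1 | `[< exists (q : 'cV[R]_n) (p : 'I_k -> 'cV[R]_n),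
       [/\ S q, forall i, S (p i) &
           row_free (\matrix_(i < k, j < n) ((p i - q) j 0)%R)] >]) k)%N.

Definition is_face (R : realType) (n : nat) (P F : set 'cV[R]_n) : Prop :=
  exists (w : 'cV[R]_n) (delta : R),
    (forall y, P y -> dot w y <= delta) /\
    F = [set y | P y /\ dot w y = delta].

Definition is_edge (R : realType) (n : nat) (P E : set 'cV[R]_n) : Prop :=
  is_face P E /\ affdim E = 1%N.

Definition neighbor (R : realType) (n : nat) (P : set 'cV[R]_n)
    (x u : 'cV[R]_n) : Prop :=
  [/\ vertex P x, vertex P u, x <> u & exists E, [/\ is_edge P E, E x & E u]].

Definition improving (R : realType) (n : nat) (P : set 'cV[R]_n)
    (w x : 'cV[R]_n) : set 'cV[R]_n :=
  [set u | neighbor P x u /\ dot w x < dot w u].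

Definition cstar (R : realType) (n : nat) (c : 'cV[R]_n) : R :=
  \sum_k `|c k 0| + 2.

(* Coordinates are numbered from 0, so the 1-based index of k is k.+1.  Since
   x0 is a 0/1 vector, the exponent x0(k) of -1 is the truth value of
   x0(k) = 1. *)
Definition shadow_vec (R : realType) (n : nat) (c x0 : 'cV[R]_n) : 'cV[R]_n :=
  \col_k ((-1) ^+ (x0 k 0 == 1) * cstar c ^+ k.+1).

Definition ordered_shadow_step (R : realType) (n : nat) (P : set 'cV[R]_n)
    (c x0 x y : 'cV[R]_n) : Prop :=
  let v := shadow_vec c x0 in
  ~ argmax P (dot c) x /\
  argmax (improving P v x) (fun u => dot c (u - x) / dot v (u - x)) y.

(* The first N steps of a run; the values of x beyond N are irrelevant. *)
Definition ordered_shadow_path (R : realType) (n : nat) (P : set 'cV[R]_n)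
    (c x0 : 'cV[R]_n) (N : nat) (x : nat -> 'cV[R]_n) : Prop :=
  x 0%N = x0 /\
  forall i, (i < N)%N -> ordered_shadow_step P c x0 (x i) (x i.+1).

(* As above, k.+1 is the 1-based index of coordinate k. *)
Definition last_diff (R : realType) (n : nat) (x0 u : 'cV[R]_n) : nat :=
  (\max_(k < n | (u k 0 - x0 k 0)%R != 0%R) k.+1)%N.

Definition Nmin (R : realType) (n : nat) (P : set 'cV[R]_n)
    (c x0 x : 'cV[R]_n) : set 'cV[R]_n :=
  [set u | improving P c x u /\
     forall u', improving P c x u' -> (last_diff x0 u <= last_diff x0 u')%N].

(* Main.v *)
(* Write C = c^* and h u = v^T (u - x0), which on 0/1 vectors is the sum of the
   C^k over the coordinates k where u differs from x0.  Two invariants hold at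
   every vertex x of the path: for some lam > 0, x maximizes c - lam v over P;
   and x is c-maximal among the vertices u with f u <= f x.  By the first,
   c-improving neighbors are v-improving; by the second, they increase f.  If
   the rule moves from x to y with slope lam = c^T(y - x) / v^T(y - x), both x and
   y maximize c - lam v, because a vertex without improving neighbors is optimal.
   With k = f y > f x and S = C + ... + C^(k-1), the identity
   (C - 1) S = C^k - C yields lam S < 1.  A vertex u with f u <= k has
   v^T(u - y) <= S, so c^T(u - y) <= lam S < 1 and hence <= 0 by integrality;
   likewise f u < k gives c^T(u - x) <= lam S < 1, so u is not c-improving at x.
   As f strictly increases along the path, the differences x^i - x0 are linearly
   independent, which bounds the number of steps by the dimension. *)
Require Import Defs.
From mathcomp Require Import all_boot all_order all_algebra.
From mathcomp Require Import boolp classical_sets reals topology normedtype.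
From mathcomp Require Import ring lra.

Set Implicit Arguments.
Unset Strict Implicit.

Import Order.TTheory GRing.Theory Num.Theory.
Import numFieldNormedType.Exports.

Local Open Scope classical_set_scope.
Local Open Scope ring_scope.

(** * Linearity of the dot product *)

Section Dot.
Context {R : realType} {n : nat}.
Implicit Types w x y : 'cV[R]_n.

Lemma dotE w x : dot w x = \sum_k w k 0 * x k 0.
Proof. by rewrite /dot mxE; apply: eq_bigr => k _; rewrite mxE. Qed.

Lemma dotDr w x y : dot w (x + y) = dot w x + dot w y.
Proof. by rewrite /dot mulmxDr mxE. Qed.

Lemma dotNr w x : dot w (- x) = - dot w x.
Proof. by rewrite /dot mulmxN mxE. Qed.

Lemma dotBr w x y : dot w (x - y) = dot w x - dot w y.
Proof. by rewrite dotDr dotNr. Qed.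

Lemma dotZr w a x : dot w (a *: x) = a * dot w x.
Proof. by rewrite /dot -scalemxAr mxE. Qed.

Lemma dotBl w y x : dot (w - y) x = dot w x - dot y x.
Proof. by rewrite /dot linearB mulmxBl !mxE. Qed.

Lemma dotZl a w x : dot (a *: w) x = a * dot w x.
Proof. by rewrite /dot linearZ -scalemxAl mxE. Qed.

End Dot.

(** * Step lengths along a direction *)

(** [t] is the least ratio [s i / a i] over the indices with [0 < a i]; the others never block. *)
Lemma ratio_test (R : realFieldType) (I : finType) (a s : I -> R) :
  (forall i, 0 <= s i) -> (exists i, 0 < a i) ->
  exists t, [/\ 0 <= t, forall i, t * a i <= s i
              & exists2 i, 0 < a i & t * a i = s i].
Proof.
move=> s0 [i0 ai0].
have [i ai imin] := @arg_minP _ _ _ i0 (fun i => 0 < a i) (fun i => s i / a i) ai0.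
exists (s i / a i); split; first by rewrite divr_ge0// ltW.
  move=> j; have [aj|aj] := ltP 0 (a j).
    by rewrite -ler_pdivlMr//; apply: imin.
  by rewrite (le_trans _ (s0 j))// mulr_ge0_le0// divr_ge0// ltW.
by exists i => //; rewrite divfK// gt_eqF.
Qed.

(** The ratio-test step is positive: were it 0, the blocking index would have no slack, hence
    [a i <= 0]. *)
Lemma feasible_step (R : realFieldType) (I : finType) (a s : I -> R) :
  (forall i, 0 <= s i) -> (forall i, s i = 0 -> a i <= 0) ->
  exists2 t, 0 < t & forall i, t * a i <= s i.
Proof.
move=> s0 sa; have [a_gt0|a_le0] := pselect (exists i, 0 < a i).
  have [t [t0 ta [i ai tai]]] := ratio_test s0 a_gt0.
  exists t => //; rewrite lt_def t0 andbT; apply/eqP => t_eq0.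
  by have := sa i; rewrite -tai t_eq0 mul0r => /(_ erefl); rewrite leNgt ai.
exists 1 => // i; rewrite mul1r (le_trans _ (s0 i))// leNgt.
by apply/negP => ai; apply: a_le0; exists i.
Qed.

(** * Existence of an improving neighbor at a non-optimal vertex *)

Section ImprovingNeighbor.
Context {R : realType} {m p n : nat}.
Variables (A : 'M[R]_(m, n)) (b : 'cV[R]_m) (D : 'M[R]_(p, n)) (d : 'cV[R]_p).
Let P := polyhedron A b D d.
Implicit Types w x y z r : 'cV[R]_n.

Lemma polyhedron_translate x z t : P x -> A *m z = 0 ->
  (forall i, t * (D *m z) i 0 <= d i 0 - (D *m x) i 0) -> P (x + t *: z).
Proof.
move=> [Ax Dx] Az Dz; split; first by rewrite mulmxDr -scalemxAr Az scaler0 addr0.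
by move=> i; rewrite mulmxDr -scalemxAr mxE [X in _ + X]mxE addrC -lerBrDr.
Qed.

Definition active x i := (D *m x) i 0 == d i 0.

(** Small steps along [z] and [-z] both stay in [P], so [z != 0] would place [x] inside a segment of
    [P]. *)
Lemma vertex_pointed x z : vertex P x -> A *m z = 0 ->
  (forall i, active x i -> (D *m z) i 0 = 0) -> z = 0.
Proof.
move=> [Px xext] Az Dz.
have slack i : 0 <= d i 0 - (D *m x) i 0 by rewrite subr_ge0; apply: Px.2.
have tight i : d i 0 - (D *m x) i 0 = 0 -> (D *m z) i 0 = 0.
  by move/eqP; rewrite subr_eq0 eq_sym => /Dz.
have [|s s0 Ps] := feasible_step (a := fun i => (D *m z) i 0) slack.
  by move=> i /tight ->.
have [|t t0 Pt] := feasible_step (a := fun i => - (D *m z) i 0) slack.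
  by move=> i /tight ->; rewrite oppr0.
have Pxs : P (x + s *: z) by exact: polyhedron_translate.
have Pxt : P (x + (- t) *: z).
  by apply: polyhedron_translate => // i; rewrite mulNr -mulrN.
have st0 : s + t != 0 by rewrite gt_eqF ?addr_gt0.
have th01 : 0 < t / (s + t) < 1.
  by rewrite divr_gt0 ?addr_gt0//= ltr_pdivrMr ?addr_gt0// mul1r ltrDr.
have /(xext _ _ _ Pxs Pxt th01)/eqP : x = (t / (s + t)) *: (x + s *: z) + (1 - t / (s + t)) *: (x + (- t) *: z).
  by apply/matrixP => i j; rewrite !mxE; field.
rewrite -subr_eq0 opprD addrACA subrr add0r.
by rewrite -scalerBl scaler_eq0 opprK (negPf st0) => /eqP.
Qed.

(** The cone of feasible directions at a point [x] of [P]. *)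
Definition tangent x z :=
  A *m z = 0 /\ forall i, active x i -> (D *m z) i 0 <= 0.

Definition tight_set x z : {set 'I_p} :=
  [set i | active x i && ((D *m z) i 0 == 0)]%SET.

(* A tangent direction with w-value > 0 and as many tight active constraints as
   possible is extreme: otherwise moving it within its tight subspace, along a
   direction of w-value 0, would make one more constraint tight. *)
Lemma improving_extreme_ray x w y : vertex P x -> P y -> dot w x < dot w y ->
  exists r, [/\ tangent x r, 0 < dot w r
    & forall z, A *m z = 0 -> (forall i, i \in tight_set x r -> (D *m z) i 0 = 0) ->
        exists t, z = t *: r].
Proof.
move=> vx Py wxy; have [Px _] := vx.
pose Q k := `[< exists r, [/\ tangent x r, 0 < dot w r & #|tight_set x r| = k] >].
have exQ : exists k, Q k.
  exists #|tight_set x (y - x)|; apply/asboolP; exists (y - x); split => //.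
    split; first by rewrite mulmxBr Py.1 Px.1 subrr.
    by move=> i /eqP Dx; rewrite mulmxBr mxE [X in _ + X]mxE Dx subr_le0; apply: Py.2.
  by rewrite dotBr subr_gt0.
have Qub k : Q k -> (k <= p)%N.
  by move=> /asboolP[r [_ _ <-]]; rewrite -[X in (_ <= X)%N]card_ord max_card.
case: (ex_maxnP exQ Qub) => k /asboolP[r [[Ar Dr] wr rk]] kmax.
exists r; split => // z Az Dz; exists (dot w z / dot w r).
apply/eqP; rewrite -subr_eq0; apply/negPn/negP => z'_neq0.
have [z' [Az' Dz' wz' z'N0]] : exists z', [/\ A *m z' = 0,
    forall i, i \in tight_set x r -> (D *m z') i 0 = 0, dot w z' = 0 & z' != 0].
  exists (z - (dot w z / dot w r) *: r); split=> //.
  - by rewrite mulmxBr -scalemxAr Az Ar scaler0 subrr.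
  - move=> i ir; rewrite mulmxBr -scalemxAr mxE Dz// [X in _ + X]mxE [X in - X]mxE.
    by move: ir; rewrite inE => /andP[_ /eqP->]; rewrite mulr0 subrr.
  - by rewrite dotBr dotZr divfK ?subrr// gt_eqF.
(* By pointedness some active row is nonzero on [z']; passing to [-z'] if needed makes it
   positive. *)
wlog [i0 xi0 Di0] : z' Az' Dz' wz' z'N0 / exists2 i, active x i & 0 < (D *m z') i 0.
  move=> gain.
  have [i xi Di] : exists2 i, active x i & (D *m z') i 0 != 0.
    apply: contrapT => h; move/eqP: z'N0; apply.
    apply: (vertex_pointed vx) => // i xi.
    by apply/eqP/negPn/negP => Di; apply: h; exists i.
  have [Di0|Di0] := ltP 0 ((D *m z') i 0); first by apply: (gain z') => //; exists i.
  apply: (gain (- z')); rewrite ?mulmxN ?Az' ?dotNr ?wz' ?oppr0 ?oppr_eq0//.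
    by move=> j jr; rewrite mxE Dz' ?oppr0.
  by exists i => //; rewrite mxE oppr_gt0 lt_neqAle Di.
pose s i := if active x i then - (D *m r) i 0 else 0.
pose a i := if active x i then (D *m z') i 0 else 0.
have [|| t [t0 ta [i]]] := @ratio_test _ _ a s.
- by move=> i; rewrite /s; case: ifPn => // xi; rewrite oppr_ge0 Dr.
- by exists i0; rewrite /a xi0.
rewrite /a /s; case: ifPn => [xi|]; last by rewrite ltxx.
move=> Di tDi.
have DE j : (D *m (r + t *: z')) j 0 = (D *m r) j 0 + t * (D *m z') j 0.
  by rewrite mulmxDr -scalemxAr mxE [X in _ + X]mxE.
suff /kmax : Q #|tight_set x (r + t *: z')|.
  rewrite -rk leqNgt => /negP; apply; apply: proper_card; apply/properP; split.
    apply/fintype.subsetP => j jr; rewrite inE DE (Dz' _ jr) mulr0 addr0.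
    by move: jr; rewrite inE.
  exists i; first by rewrite inE xi DE tDi subrr eqxx.
  by apply/negP => ir; rewrite Dz' ?ltxx in Di.
apply/asboolP; exists (r + t *: z'); split => //.
  split; first by rewrite mulmxDr -scalemxAr Ar Az' scaler0 addr0.
  by move=> j xj; rewrite DE; have := ta j; rewrite /a /s xj; lra.
by rewrite dotDr dotZr wz' mulr0 addr0.
Qed.

(** The whole ray from [x] along [r] stays in [P], so [r != 0] would give points of arbitrarily
    large norm. *)
Lemma bounded_ray x r : bounded_set P -> P x -> A *m r = 0 ->
  (forall i, (D *m r) i 0 <= 0) -> r = 0.
Proof.
move=> [M [_ MP]] Px Ar Dr; apply/eqP/negPn/negP; rewrite -normr_gt0 => r0.
pose t := (`|M| + 1 + `|x|) / `|r|.
have t0 : 0 <= t by rewrite divr_ge0// !addr_ge0.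
have Pt : P (x + t *: r).
  apply: polyhedron_translate => // i.
  by rewrite (@le_trans _ _ 0) ?mulr_ge0_le0// subr_ge0; apply: Px.2.
have MM : M < `|M| + 1 / 2 by have := ler_norm M; lra.
have := MP _ MM _ Pt; apply/negP; rewrite -ltNge.
have : `|t *: r| <= `|x + t *: r| + `|x|.
  by have := ler_normB (x + t *: r) x; rewrite [x + _ - x]addrC addKr.
rewrite normrZ (ger0_norm t0) divfK ?gt_eqF//; lra.
Qed.

(** All differences are multiples of [r], so the matrix in [affdim] is a column times a row, of rank
    at most 1; [u - x] attains rank 1. *)
Lemma affdim_segment (E : set 'cV[R]_n) x u r : E x -> E u -> x <> u ->
  (forall y, E y -> exists t, y = x + t *: r) -> affdim E = 1%N.
Proof.
move=> Ex Eu xu Er; apply/eqP; rewrite eqn_leq; apply/andP; split.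
  apply/bigmax_leqP => k /asboolP[q [z [Eq Ez]]].
  rewrite /row_free => /eqP <-.
  suff -> : \matrix_(i < k, j < n) (z i - q) j 0 =
      (\col_i sval (cid (Er _ (Ez i))) - const_mx (sval (cid (Er _ Eq)))) *m r^T.
    by rewrite (leq_trans (mxrankM_maxl _ _))// rank_leq_col.
  apply/matrixP => i j; rewrite !mxE big_ord1 !mxE.
  case: cid => t /= ->; case: cid => s /= ->; rewrite !mxE; ring.
have n0 : (1 < n.+1)%N.
  case: n x u r xu {Ex Eu Er E} => // x u _ []; apply/matrixP => -[].
  by [].
apply: (bigop.bigmax_sup (Ordinal n0)) => //; apply/asboolP.
exists x, (fun=> u); split => //; rewrite /row_free eqn_leq rank_leq_row /=.
rewrite lt0n mxrank_eq0; apply/eqP => /matrixP M0; apply: xu.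
apply/matrixP => i j; have := M0 0 i; rewrite !mxE ord1.
by move=> /eqP; rewrite subr_eq0 => /eqP.
Qed.

(** A simplex pivot: follow an extreme improving direction until a constraint blocks, which
    boundedness guarantees. *)
Lemma improving_neighbor x w y : bounded_set P -> vertex P x -> P y ->
  dot w x < dot w y -> exists u, improving P w x u.
Proof.
move=> Pbd vx Py wxy; have [Px _] := vx.
have [r [[Ar Dr] wr rspan]] := improving_extreme_ray vx Py wxy.
have rN0 : r != 0 by apply: contraTneq wr => ->; rewrite /dot mulmx0 mxE ltxx.
have [||t [t0 tD [i0 Di0 tDi0]]] := @ratio_test _ _ (fun i => (D *m r) i 0)
    (fun i => d i 0 - (D *m x) i 0).
- by move=> i; rewrite subr_ge0; apply: Px.2.
- apply: contrapT => h; move/eqP: rN0; apply; apply: (bounded_ray Pbd Px Ar).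
  by move=> i; rewrite leNgt; apply/negP => Di; apply: h; exists i.
(* The blocking row increases along [r], so it is not active at [x] and has slack. *)
have {}t0 : 0 < t.
  rewrite lt_def t0 andbT; apply/eqP => t_eq0; move: tDi0.
  rewrite t_eq0 mul0r => /esym/eqP; rewrite subr_eq0 eq_sym => /Dr.
  by rewrite leNgt Di0.
pose u := x + t *: r.
have Pu : P u by exact: polyhedron_translate.
have xu : x <> u.
  move=> /eqP; rewrite /u -subr_eq0 opprD addrA subrr sub0r oppr_eq0 scaler_eq0.
  by rewrite (negPf rN0) gt_eqF.
pose T := tight_set x r.
(* On [P], the sum [h] of the tight rows reaches its bound [delta] exactly where each of these rows
   is tight. *)
pose h : 'cV[R]_n := \col_k \sum_(i in T) D i k.
pose delta := \sum_(i in T) d i 0.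
pose E : set 'cV[R]_n := [set y | P y /\ dot h y = delta].
have hE z : dot h z = \sum_(i in T) (D *m z) i 0.
  rewrite dotE; under eq_bigr do rewrite mxE mulr_suml.
  by rewrite exchange_big; apply: eq_bigr => i _; rewrite mxE.
have hle z : P z -> dot h z <= delta.
  by move=> Pz; rewrite hE; apply: ler_sum => i _; apply: Pz.2.
have Ez z : E z -> forall i, i \in T -> (D *m z) i 0 = d i 0.
  move=> [Pz]; rewrite hE => /eqP; rewrite -subr_eq0 -sumrB => /eqP hz i iT.
  apply/eqP; rewrite -subr_eq0; move: hz => /eqP.
  rewrite -oppr_eq0 -sumrN psumr_eq0 => [/allP/(_ i)|j _].
    by rewrite mem_index_enum iT oppr_eq0 => /(_ isT).
  by rewrite opprB subr_ge0; apply: Pz.2.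
have xT i : i \in T -> (D *m x) i 0 = d i 0 by rewrite inE => /andP[/eqP].
have Eline z : E z -> exists s, z = x + s *: r.
  move=> zE; have [||s sE] := rspan (z - x).
  - by rewrite mulmxBr zE.1.1 Px.1 subrr.
  - by move=> i iT; rewrite mulmxBr mxE [X in _ + X]mxE Ez ?xT ?subrr.
  by exists s; rewrite -sE addrC subrK.
have Ex : E x by split => //; rewrite hE; apply: eq_bigr => i /xT.
have Eu : E u.
  split => //; rewrite hE; apply: eq_bigr => i iT; rewrite mulmxDr -scalemxAr mxE.
  rewrite xT// [X in _ + X]mxE; move: iT; rewrite inE => /andP[_ /eqP ->].
  by rewrite mulr0 addr0.
(* If [u] lies between [y1] and [y2], both are in [E], at parameters at most [t] since row [i0] is
   tight at [u]; their weighted mean is [t], so both equal [t]. *)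
have vu : vertex P u.
  split => // y1 y2 a P1 P2 /andP[a0 a1] uE.
  have huE : a * dot h y1 + (1 - a) * dot h y2 = delta.
    by rewrite -!dotZr -dotDr -uE Eu.2.
  have a1' : 0 < 1 - a by rewrite subr_gt0.
  have h1 := hle _ P1; have h2 := hle _ P2.
  have E1 : E y1 by split => //; nra.
  have E2 : E y2 by split => //; nra.
  have [s1 s1E] := Eline _ E1; have [s2 s2E] := Eline _ E2.
  have le_t s : P (x + s *: r) -> s <= t.
    move=> Ps; have := Ps.2 i0; rewrite mulmxDr -scalemxAr mxE [X in _ + X]mxE.
    by rewrite addrC -lerBrDr -tDi0 ler_pM2r.
  have s1t : s1 <= t by apply: le_t; rewrite -s1E.
  have s2t : s2 <= t by apply: le_t; rewrite -s2E.
  have : (a * s1 + (1 - a) * s2 - t) *: r = 0.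
    move: uE; rewrite s1E s2E /u => /matrixP uE; apply/matrixP => i j.
    have := uE i j; rewrite !mxE => e.
    have -> : (a * s1 + (1 - a) * s2 - t) * r i j =
      a * (x i j + s1 * r i j) + (1 - a) * (x i j + s2 * r i j) -
      (x i j + t * r i j) by ring.
    by rewrite -e subrr.
  move=> /eqP; rewrite scaler_eq0 (negPf rN0) orbF => /eqP st.
  by rewrite s1E s2E; congr (_ + _ *: _); nra.
exists u; split; last by rewrite dotDr dotZr ltrDl mulr_gt0.
split => //; exists E; split => //; split; first by exists h, delta.
exact: affdim_segment Ex Eu xu Eline.
Qed.

End ImprovingNeighbor.

(** * Bounds for 0/1 vectors and their last differing coordinate *)

Lemma ler_sum_pred (R : numDomainType) (I : finType) (Q1 Q2 : pred I) (F : I -> R) :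
  (forall i, Q1 i -> Q2 i) -> (forall i, 0 <= F i) ->
  \sum_(i | Q1 i) F i <= \sum_(i | Q2 i) F i.
Proof.
move=> Q12 F0; rewrite big_mkcond [leRHS]big_mkcond; apply: ler_sum => i _.
by case: ifPn => [/Q12 ->//|_]; case: ifP.
Qed.

Section ZeroOne.
Context {R : realType} {n : nat}.
Implicit Types c u x : 'cV[R]_n.

Lemma dot_zero_one_int c u x : c \is a mxOver Num.int -> zero_one u -> zero_one x ->
  dot c (u - x) \is a Num.int.
Proof.
move=> /mxOverP cint u01 x01.
have int01 z k : zero_one z -> z k 0 \is a Num.int.
  by move=> /(_ k)[] ->; rewrite ?rpred0 ?rpred1.
rewrite dotE rpred_sum// => k _; rewrite rpredM//.
by rewrite !mxE rpredB// int01.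
Qed.

Lemma dot_zero_one_le c u x : zero_one u -> zero_one x ->
  dot c (u - x) <= cstar c - 2.
Proof.
move=> u01 x01; rewrite /cstar addrK dotE; apply: ler_sum => k _.
rewrite (le_trans (ler_norm _))// normrM ler_piMr// !mxE.
by case: (u01 k) => ->; case: (x01 k) => ->;
  rewrite ?subrr ?subr0 ?sub0r ?normrN ?normr0 ?normr1.
Qed.

Lemma int_gt0_ge1 (a : R) : a \is a Num.int -> 0 < a -> 1 <= a.
Proof.
by move=> aint a0; rewrite -[a]gtr0_norm// norm_intr_ge1// gt_eqF.
Qed.

(** A set of 0/1 vectors is finite, being encoded by Boolean functions. *)
Lemma zero_one_argmax (S : set 'cV[R]_n) (g : 'cV[R]_n -> R) :
  (forall u, S u -> zero_one u) -> S !=set0 -> exists u, argmax S g u.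
Proof.
move=> S01 [u0 Su0].
pose B (e : {ffun 'I_n -> bool}) : 'cV[R]_n := \col_k (e k)%:R.
have SB u : S u -> exists e, u = B e.
  move=> /S01 u01; exists [ffun k => u k 0 == 1]; apply/matrixP => k j.
  rewrite !mxE ffunE ord1; case: (u01 k) => ->; last by rewrite eqxx.
  by rewrite eq_sym oner_eq0.
have [e0 e0E] := SB _ Su0; have Qe0 : `[< S (B e0) >] by apply/asboolP; rewrite -e0E.
have [e /asboolP Se emax] := @arg_maxP _ _ _ e0 (fun e => `[< S (B e) >]) (fun e => g (B e)) Qe0.
exists (B e); split=> // u Su; have [e' e'E] := SB _ Su.
by rewrite e'E; apply: emax; apply/asboolP; rewrite -e'E.
Qed.

(** [last_diff] is 1-based and [k] 0-based, so [j <= k] puts the coordinate strictly beyond position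
    [j]. *)
Lemma last_diff_le_eq x u j (k : 'I_n) : (last_diff x u <= j)%N -> (j <= k)%N ->
  u k 0 = x k 0.
Proof.
move=> /bigmax_leqP uj jk; apply/eqP; rewrite -subr_eq0; apply/negPn/negP.
by move=> /uj; rewrite leqNgt ltnS jk.
Qed.

Lemma last_diff_attained x u j : last_diff x u = j.+1 ->
  exists2 k : 'I_n, k = j :> nat & u k 0 - x k 0 != 0.
Proof.
move=> uj; apply: contrapT => h; have : (last_diff x u <= j)%N.
  apply/bigmax_leqP => k ukx.
  have : (k.+1 <= last_diff x u)%N by apply: leq_bigmax_cond.
  rewrite uj ltnS leq_eqVlt => /orP[/eqP kj|//].
  by exfalso; apply: h; exists k.
by rewrite uj ltnn.
Qed.

End ZeroOne.

(** * The shadow vector and the slope of a move *)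

Section ShadowVector.
Context {R : realType} {n : nat}.
Variables c x0 : 'cV[R]_n.
Hypothesis x001 : zero_one x0.
Let C := cstar c.
Let v := shadow_vec c x0.
Let S j := \sum_(l < j) C ^+ l.+1.
Implicit Types u x y : 'cV[R]_n.

Lemma cstar_ge2 : 2 <= C.
Proof. by rewrite lerDr sumr_ge0. Qed.

Lemma cstar_exp_ge0 k : 0 <= C ^+ k.
Proof. by rewrite exprn_ge0// (le_trans _ cstar_ge2). Qed.

Lemma geometric_ge0 j : 0 <= S j.
Proof. by apply: sumr_ge0 => l _; exact: cstar_exp_ge0. Qed.

Lemma geometric_sum j : (C - 1) * S j = C ^+ j.+1 - C.
Proof.
rewrite /S; under eq_bigr do rewrite exprS.
by rewrite -mulr_sumr mulrCA -subrX1 exprS mulrBr mulr1.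
Qed.

(** The sign in [v] is that of [u k 0 - x0 k 0] wherever these differ, so each product is a bare
    power of [C]. *)
Lemma dot_shadow_vec u : zero_one u ->
  dot v (u - x0) = \sum_(k | u k 0 - x0 k 0 != 0) C ^+ k.+1.
Proof.
move=> u01; rewrite dotE [RHS]big_mkcond; apply: eq_bigr => k _; rewrite !mxE.
case: (u01 k) => ->; case: (x001 k) => ->;
  rewrite ?subrr ?eqxx ?subr0 ?sub0r ?oppr_eq0 ?oner_eq0 /= ?mulr0//.
- by rewrite expr1 mulN1r mulrN1 opprK.
- by rewrite eq_sym oner_eq0 expr0 mul1r mulr1.
Qed.

Lemma dot_shadow_vec_ge0 u : zero_one u -> 0 <= dot v (u - x0).
Proof.
by move=> u01; rewrite dot_shadow_vec// sumr_ge0// => k _; exact: cstar_exp_ge0.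
Qed.

Lemma dot_shadow_vec_le u j : zero_one u -> (last_diff x0 u <= j)%N ->
  dot v (u - x0) <= S j.
Proof.
move=> u01 uj; rewrite dot_shadow_vec//.
apply: (@le_trans _ _ (\sum_(k < n | (k < j)%N) C ^+ k.+1)).
  apply: ler_sum_pred => [k|k]; last exact: cstar_exp_ge0.
  apply: contraNT; rewrite -leqNgt => jk.
  by rewrite (last_diff_le_eq uj jk) subrr.
(* [j] may exceed [n]; then [S j] only has additional nonnegative terms. *)
have [jn|nj] := leqP j n; first by rewrite /S (big_ord_widen _ (fun k => C ^+ k.+1) jn).
rewrite (@le_trans _ _ (\sum_(k < n) C ^+ k.+1))//.
  by apply: ler_sum_pred => // k; exact: cstar_exp_ge0.
rewrite /S (big_ord_widen _ (fun k => C ^+ k.+1) (ltnW nj)).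
by apply: ler_sum_pred => // k; exact: cstar_exp_ge0.
Qed.

Lemma dot_shadow_vec_ge u j : zero_one u -> last_diff x0 u = j.+1 ->
  C ^+ j.+1 <= dot v (u - x0).
Proof.
move=> u01 /last_diff_attained[k <- uk]; rewrite dot_shadow_vec// (bigD1 k)//=.
by rewrite lerDl sumr_ge0// => l _; exact: cstar_exp_ge0.
Qed.

(** The numerator is at most [C - 2] and the denominator at least [C ^+ j.+1 - S j], which is
    [(C - 2) * S j + C] by [geometric_sum]. *)
Lemma shadow_slope x y j : zero_one x -> zero_one y -> (last_diff x0 x <= j)%N ->
  last_diff x0 y = j.+1 ->
  0 < dot v (y - x) /\ dot c (y - x) / dot v (y - x) * S j < 1.
Proof.
move=> x01 y01 xj yj.
have VE : dot v (y - x) = dot v (y - x0) - dot v (x - x0) by rewrite !dotBr; ring.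
have hy := dot_shadow_vec_ge y01 yj; have hx := dot_shadow_vec_le x01 xj.
have g := geometric_sum j; have S0 := geometric_ge0 j; have C2 := cstar_ge2.
have cle := dot_zero_one_le c y01 x01; rewrite -/C in cle.
have V0 : 0 < dot v (y - x) by rewrite VE; nra.
split => //; rewrite mulrAC ltr_pdivrMr// mul1r VE.
by have := ler_wpM2r S0 cle; nra.
Qed.

Lemma last_diff_eq0 u : (last_diff x0 u <= 0)%N -> u = x0.
Proof. by move=> u0; apply/matrixP => k l; rewrite ord1 (last_diff_le_eq u0). Qed.

(** With [last_diff x0 u = j.+1], the right side is at least [C ^+ j.+1 >= C], the left at most
    [C - 2]. *)
Lemma dot_shadow_vec_initial u : zero_one u -> u <> x0 ->
  dot c (u - x0) < dot v (u - x0).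
Proof.
move=> u01 ux0; case Eu : (last_diff x0 u) => [|j].
  by exfalso; apply: ux0; apply: last_diff_eq0; rewrite Eu.
have := dot_shadow_vec_ge u01 Eu; have := dot_zero_one_le c u01 x001.
have := geometric_sum j; have := geometric_ge0 j; have := cstar_ge2.
by rewrite -/C; nra.
Qed.

End ShadowVector.

(** * Invariants preserved by a step of the rule *)

Section OrderedShadow.
Context {R : realType} {m p n : nat}.
Variables (A : 'M[R]_(m, n)) (b : 'cV[R]_m) (D : 'M[R]_(p, n)) (d : 'cV[R]_p).
Variables c x0 : 'cV[R]_n.
Let P := polyhedron A b D d.
Hypothesis cint : c \is a mxOver Num.int.
Hypothesis P01 : zero_one_polytope P.
Hypothesis vx0 : vertex P x0.
Let v := shadow_vec c x0.
Implicit Types u x y : 'cV[R]_n.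

Let vertex01 x : vertex P x -> zero_one x.
Proof. exact: P01.2. Qed.

(* The second clause says that x lies on the shadow of P spanned by c and v. *)
Definition on_shadow x :=
  [/\ vertex P x,
      exists2 lam, 0 < lam & forall u, P u -> dot c (u - x) <= lam * dot v (u - x)
    & forall u, vertex P u -> (last_diff x0 u <= last_diff x0 x)%N ->
        dot c u <= dot c x].

(** Slope 1 works at the start: a neighbor improving for [c - v] would contradict
    [dot_shadow_vec_initial]. *)
Lemma on_shadow_initial : on_shadow x0.
Proof.
split => //.
  exists 1 => // u Pu; rewrite mul1r leNgt; apply/negP => cu.
  have : dot (c - v) x0 < dot (c - v) u by rewrite !dotBl; move: cu; rewrite !dotBr; lra.
  move=> /(improving_neighbor P01.1 vx0 Pu)[z [[_ vz x0z _]]].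
  have := dot_shadow_vec_initial c (vertex01 vx0) (vertex01 vz) (nesym x0z).
  by rewrite !dotBl !dotBr -/v; lra.
move=> u _; have -> : last_diff x0 x0 = 0%N.
  by rewrite /last_diff big1// => k; rewrite subrr eqxx.
by move=> /last_diff_eq0 ->.
Qed.

Lemma on_shadow_improving x u : on_shadow x -> improving P c x u ->
  improving P v x u /\ (last_diff x0 x < last_diff x0 u)%N.
Proof.
move=> [vx [lam lam0 xlam] xmax] [xu cxu]; have [_ vu _ _] := xu.
split; last by rewrite ltnNge; apply/negP => /(xmax _ vu); rewrite leNgt cxu.
split => //; have := xlam _ vu.1; rewrite -subr_gt0 -dotBr => le_cv.
by rewrite -(pmulr_rgt0 _ lam0) (lt_le_trans _ le_cv)// dotBr subr_gt0.
Qed.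

Lemma not_argmax_improving x : vertex P x -> ~ argmax P (dot c) x ->
  improving P c x !=set0.
Proof.
move=> vx xNopt; apply: contrapT => xloc; apply: xNopt; split; first exact: vx.1.
move=> y Py; rewrite leNgt; apply/negP => cxy; apply: xloc.
by have [u] := improving_neighbor P01.1 vx Py cxy; exists u.
Qed.

(** The rule is never stuck: a [c]-improving neighbor is [v]-improving, and the best ratio is
    attained among finitely many candidates. *)
Lemma ordered_shadow_step_total x : on_shadow x -> ~ argmax P (dot c) x ->
  exists y, ordered_shadow_step P c x0 x y.
Proof.
move=> xsh xNopt; have [vx _ _] := xsh.
have [u /(on_shadow_improving xsh)[vu _]] := not_argmax_improving vx xNopt.
have [||y ymax] := @zero_one_argmax R n (improving P v x)
    (fun u => dot c (u - x) / dot v (u - x)).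
- by move=> z [[_ vz _ _] _]; exact: vertex01.
- by exists u.
- by exists y.
Qed.

Lemma ordered_shadow_stepP x y : on_shadow x -> ordered_shadow_step P c x0 x y ->
  [/\ on_shadow y, (last_diff x0 x < last_diff x0 y)%N
    & argmax (Nmin P c x0 x) (dot c) y].
Proof.
move=> xsh [xNopt [[xy vxy] ymax]]; have [vx [lam0 lam00 xlam0] _] := xsh.
have [_ vy _ _] := xy; rewrite -/v in vxy ymax.
set lam := dot c (y - x) / dot v (y - x) in ymax.
have V0 : 0 < dot v (y - x) by rewrite dotBr subr_gt0.
have cyx : dot c (y - x) = lam * dot v (y - x) by rewrite divfK// gt_eqF.
have lam_gt0 : 0 < lam.
  have [u uimp] := not_argmax_improving vx xNopt.
  have [vu _] := on_shadow_improving xsh uimp.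
  apply: lt_le_trans (ymax _ vu).
  by rewrite divr_gt0// dotBr subr_gt0; [exact: uimp.2|exact: vu.2].
have cxy : dot c x < dot c y by rewrite -subr_gt0 -dotBr cyx mulr_gt0.
have yimp : improving P c x y by [].
have lam_le : lam <= lam0 by rewrite ler_pdivrMr//; apply: xlam0; exact: vy.1.
have xlam u : P u -> dot c (u - x) <= lam * dot v (u - x).
  move=> Pu; rewrite leNgt; apply/negP => cu.
  have : dot (c - lam *: v) x < dot (c - lam *: v) u.
    by rewrite !dotBl !dotZl; move: cu; rewrite !dotBr; lra.
  move=> /(improving_neighbor P01.1 vx Pu)[z [xz]].
  rewrite -subr_gt0 -dotBr dotBl dotZl subr_gt0.
  apply/negP; rewrite -leNgt; have [_ vz _ _] := xz.
  (* If [z] is [v]-improving, the maximality of the ratio applies; otherwise [v^T(z - x) <= 0] and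
     [lam <= lam0] suffice. *)
  have [vxz|vzx] := ltP (dot v x) (dot v z).
    by rewrite -ler_pdivrMr ?dotBr ?subr_gt0// -!dotBr; apply: ymax.
  apply: (le_trans (xlam0 _ vz.1)).
  by apply: ler_wnM2r => //; rewrite dotBr subr_le0.
have ylam u : P u -> dot c (u - y) <= lam * dot v (u - y).
  by move=> /xlam; move: cyx; rewrite !dotBr; lra.
have [_ fxy] := on_shadow_improving xsh yimp.
case Ey : (last_diff x0 y) (fxy) => [//|j]; rewrite ltnS => xj.
have x001 := vertex01 vx0; have x01 := vertex01 vx; have y01 := vertex01 vy.
have [_] := shadow_slope c x001 x01 y01 xj Ey; rewrite -/v -/lam => lamS.
have hy := dot_shadow_vec_ge c x001 y01 Ey.
have hx := dot_shadow_vec_ge0 c x001 x01.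
have yface u : vertex P u -> (last_diff x0 u <= last_diff x0 y)%N -> dot c u <= dot c y.
  move=> vu; rewrite Ey => uy; rewrite leNgt; apply/negP; rewrite -subr_gt0 -dotBr.
  have u01 := vertex01 vu.
  move=> /(int_gt0_ge1 (dot_zero_one_int cint u01 y01)); apply/negP; rewrite -ltNge.
  apply: (le_lt_trans (ylam _ vu.1)); apply: le_lt_trans lamS; rewrite ler_pM2l//.
  (* The top term [C^(j+1)] of the bound for [u] is at most [v^T(y - x0)], which leaves
     [v^T(u - y) <= C + ... + C^j]. *)
  have := dot_shadow_vec_le c x001 u01 uy; rewrite big_ord_recr /=.
  by move: hy; rewrite -/v !dotBr; lra.
split => //; first by split => //; exists lam.
(* As [y] is itself [c]-improving, each [u] in [Nmin] has [last_diff x0 u <= last_diff x0 y]. *)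
split=> [|u [[[_ vu _ _] _] umin]]; last exact/yface/umin.
(* An improving [u] with [last_diff x0 u <= j] would gain at least 1 in [c] by integrality, yet at
   most [lam (C + ... + C^j) < 1]. *)
split => // u uimp; rewrite leqNgt Ey ltnS; apply/negP => uj.
have [[_ vu _ _] cxu] := uimp; have u01 := vertex01 vu.
move: cxu; rewrite -subr_gt0 -dotBr.
move=> /(int_gt0_ge1 (dot_zero_one_int cint u01 x01)); apply/negP; rewrite -ltNge.
apply: (le_lt_trans (xlam _ vu.1)); apply: le_lt_trans lamS; rewrite ler_pM2l//.
have := dot_shadow_vec_le c x001 u01 uj.
by move: hx; rewrite -/v !dotBr; lra.
Qed.

End OrderedShadow.

(** * Counting the steps by affine dimension *)

(* The vectors x i.+1 - x0 are in echelon form with respect to their last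
   nonzero coordinates. *)
Lemma last_diff_affdim (R : realType) (n : nat) (S : set 'cV[R]_n)
    (x0 : 'cV[R]_n) (N : nat) (x : nat -> 'cV[R]_n) :
  S x0 -> (forall i, (i < N)%N -> S (x i.+1)) ->
  (forall i, (i < N)%N -> (0 < last_diff x0 (x i.+1))%N) ->
  (forall i j, (i < j)%N -> (j < N)%N ->
     (last_diff x0 (x i.+1) < last_diff x0 (x j.+1))%N) ->
  (N <= affdim S)%N.
Proof.
move=> Sx0 Sx f_gt0 f_incr.
pose M := \matrix_(i < N, j < n) (x i.+1 - x0) j 0.
have Mfree : row_free M.
  apply: inj_row_free => w /matrixP wM; apply/eqP/negPn/negP => /rV0Pn[i0 wi0].
  (* At the last coordinate [k] where [x i.+1] differs from [x0], earlier vectors vanish, and later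
     coefficients are 0, so [w 0 i] would be 0. *)
  have [i wi imax] := @arg_maxnP _ i0 (fun i => w 0 i != 0) (fun i => i : nat) wi0.
  have := f_gt0 i (ltn_ord i); case Ei : (last_diff _ _) => [//|l] _.
  have [k kl] := last_diff_attained Ei; apply/negP; rewrite negbK.
  have := wM 0 k; rewrite !mxE (bigD1 i)//= big1 => [|i' i'i].
    by rewrite addr0 !mxE => /eqP; rewrite mulf_eq0 (negPf wi).
  have [->|wi'] := eqVneq (w 0 i') 0; first by rewrite mul0r.
  have ii' : (i' < i)%N by rewrite ltn_neqAle i'i; exact: imax.
  have := f_incr _ _ ii' (ltn_ord i); rewrite Ei ltnS => fi'.
  by rewrite !mxE (last_diff_le_eq fi') ?kl// subrr mulr0.
have Nn : (N < n.+1)%N by rewrite ltnS; move/eqP: Mfree => <-; exact: rank_leq_col.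
apply: (bigop.bigmax_sup (Ordinal Nn)) => //; apply/asboolP.
by exists x0, (fun i => x i.+1); split => // i; apply: Sx.
Qed.

Theorem theorem6 (R : realType) (m p n : nat)
    (A : 'M[R]_(m, n)) (b : 'cV[R]_m) (D : 'M[R]_(p, n)) (d : 'cV[R]_p)
    (c : 'cV[R]_n)
    (hA : A \is a mxOver Num.int) (hb : b \is a mxOver Num.int)
    (hD : D \is a mxOver Num.int) (hd : d \is a mxOver Num.int)
    (hc : c \is a mxOver Num.int)
    (P : set 'cV[R]_n) (hP : P = polyhedron A b D d)
    (hP01 : zero_one_polytope P)
    (x0 : 'cV[R]_n) (hx0 : vertex P x0)
    (N : nat) (x : nat -> 'cV[R]_n)
    (hx : ordered_shadow_path P c x0 N x) :
  (forall i, (i < N)%N -> argmax (Nmin P c x0 (x i)) (dot c) (x i.+1)) /\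
  ((N <= affdim P)%N /\
   (argmax P (dot c) (x N) \/ exists y, ordered_shadow_step P c x0 (x N) y)).
Proof.
subst P; have [x_0 xstep] := hx.
have xsh i : (i <= N)%N -> on_shadow A b D d c x0 (x i).
  elim: i => [_|i IH iN]; first by rewrite x_0; exact: on_shadow_initial.
  by have [] := ordered_shadow_stepP hc hP01 hx0 (IH (ltnW iN)) (xstep _ iN).
have stepP i (iN : (i < N)%N) :=
  ordered_shadow_stepP hc hP01 hx0 (xsh i (ltnW iN)) (xstep i iN).
split; first by move=> i /stepP[].
(* Together with the bound on [N], the possibility of continuing from any non-optimal vertex shows
   that the rule reaches an optimum. *)
split; last first.
  have [?|xNopt] := pselect (argmax (polyhedron A b D d) (dot c) (x N)); first by left.
  by right; exact: ordered_shadow_step_total (xsh N (leqnn N)) xNopt.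
have f_lt i : (i < N)%N -> (last_diff x0 (x i) < last_diff x0 (x i.+1))%N.
  by move=> /stepP[].
apply: (last_diff_affdim hx0.1 (x := x)).
- by move=> i /xsh[[]].
- by move=> i /f_lt; exact: leq_ltn_trans.
- move=> i j; elim: j => [//|j IH]; rewrite ltnS leq_eqVlt => ij jN.
  apply: leq_ltn_trans (f_lt _ jN).
  by case/orP: ij => [/eqP ->//|ij]; exact/ltnW/IH/ltnW.
Qed.
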